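(* Let $\Bbbk$ be a field. The forgetful functor $U:CDGC\longrightarrow Ch_{\geq 0}(\Bbbk)$ from cocommutative differential graded coalgebras to non-negatively graded chain complexes has a right adjoint $C:Ch_{\geq 0}(\Bbbk)\longrightarrow CDGC$.
   Context: $Ch_{\geq 0}(\Bbbk)$ is the category of non-negatively graded chain complexes over $\Bbbk$ with the usual tensor product and Koszul sign rule. $CDGC$ is the category of coassociative, counital, cocommutative coalgebras $(C,\triangle,\varepsilon)$ in $Ch_{\geq 0}(\Bbbk)$, where $\triangle:C\to C\otimes C$ and $\varepsilon:C\to\Bbbk$ are chain maps. *)

(* Defs.v *)
From HB Require Import structures.
From mathcomp Require Import all_boot all_algebra.
From mathcomp Require Import boolp.
From mathcomp Require Import freeg.

Set Implicit Arguments.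
Unset Strict Implicit.
Unset Printing Implicit Defensive.

Import GRing.Theory.

Local Open Scope ring_scope.
Local Open Scope quotient_scope.

Record category := Category {
  obj :> Type;
  hom : obj -> obj -> Type;
  idm : forall A, hom A A;
  compm : forall A B C, hom B C -> hom A B -> hom A C;
  comp1m : forall A B (f : hom A B), compm (idm B) f = f;
  compm1 : forall A B (f : hom A B), compm f (idm A) = f;
  compmA : forall A B C D (h : hom C D) (g : hom B C) (f : hom A B),
    compm h (compm g f) = compm (compm h g) f
}.

Arguments hom {c} _ _.
Arguments idm {c} _.
Arguments compm {c A B C} _ _.

Record functor (C D : category) := Functor {
  fobj :> C -> D;
  fmap : forall A B, hom A B -> hom (fobj A) (fobj B);
  fmap1 : forall A, fmap (idm A) = idm (fobj A);
  fmapM : forall A B E (g : hom B E) (f : hom A B),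
    fmap (compm g f) = compm (fmap g) (fmap f)
}.

Arguments fmap {C D} _ {A B} _.

(* F is left adjoint to G: a bijection Hom(F X, Y) ~ Hom(X, G Y), natural in
   X and in Y. *)
Record adjunction (C D : category) (F : functor C D) (G : functor D C) :=
  Adjunction {
  adj : forall (X : C) (Y : D), hom (F X) Y -> hom X (G Y);
  adj_bij : forall X Y, bijective (@adj X Y);
  adj_natl : forall (X X' : C) (Y : D) (f : hom X' X) (h : hom (F X) Y),
    adj (compm h (fmap F f)) = compm (adj h) f;
  adj_natr : forall (X : C) (Y Y' : D) (g : hom Y Y') (h : hom (F X) Y),
    adj (compm g h) = compm (fmap G g) (adj h)
}.


Section LinearMaps.
Variable k : fieldType.

Lemma linear_ext (V W : lmodType k) (f g : {linear V -> W}) : f =1 g -> f = g.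
Proof.
case: f g => f [[f1] [f2]] [g [[g1] [g2]]] /= fg.
have {}fg : f = g by apply: funext.
by subst g; rewrite (Prop_irrelevance f1 g1) (Prop_irrelevance f2 g2).
Qed.

Definition linear_fun_of (V W : lmodType k) (f : V -> W) of linear f := f.

HB.instance Definition _ (V W : lmodType k) (f : V -> W) (fL : linear f) :=
  GRing.isLinear.Build k V W *:%R (linear_fun_of fL) fL.

Definition mklinear (V W : lmodType k) (f : V -> W) (fL : linear f) :
  {linear V -> W} := linear_fun_of fL.

End LinearMaps.

(* The degree-n part of the graded tensor product, that is the direct sum of the
   X_i (x) Y_j over i + j = n, is presented as the k-module generated by the
   symbols x (x) y with |x| + |y| = n, subject to bilinearity. *)
Section Tensor.
Variables (k : fieldType) (X Y : nat -> lmodType k).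

Section Degree.
Variable n : nat.

Definition tgen := {p : {i : nat & X i} * {j : nat & Y j} |
  (tag p.1 + tag p.2)%N == n}.

Definition tgen_of i j (e : (i + j)%N = n) (x : X i) (y : Y j) : tgen :=
  Sub (Tagged X x, Tagged Y y) (introT eqP e).

Definition tfree := {freeg tgen / k}.

Definition fgen i j (e : (i + j)%N = n) (x : X i) (y : Y j) : tfree :=
  [freeg [:: (1, tgen_of e x y)]].

Inductive trel : tfree -> Prop :=
| trel_bill i j (e : (i + j)%N = n) c (x x' : X i) (y : Y j) :
    trel (fgen e (c *: x + x') y - (c *: fgen e x y + fgen e x' y))
| trel_bilr i j (e : (i + j)%N = n) c (x : X i) (y y' : Y j) :
    trel (fgen e x (c *: y + y') - (c *: fgen e x y + fgen e x y'))
| trel_0 : trel 0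
| trel_lin c u v : trel u -> trel v -> trel (c *: u + v).

Definition tker (u : tfree) : bool := `[< trel u >].

Lemma tker_zmod_closed : zmod_closed tker.
Proof.
split=> [|u v /asboolP Ru /asboolP Rv]; apply/asboolP; first exact: trel_0.
by rewrite -scaleN1r addrC; apply: trel_lin.
Qed.

HB.instance Definition _ := GRing.isZmodClosed.Build tfree tker tker_zmod_closed.

Definition tens : Type := {ideal_quot (GRing.ZmodClosed.clone _ tker _)}.

HB.instance Definition _ := GRing.Zmodule.on tens.
HB.instance Definition _ := EqQuotient.on tens.

Definition tpi (u : tfree) : tens := \pi_tens u.

Lemma tpi_eq u v : tpi u = tpi v <-> trel (u - v).
Proof.
rewrite /tpi; split=> [/eqP|Ruv].
  by rewrite -Quotient.idealrBE => /asboolP.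
by apply/eqP; rewrite -Quotient.idealrBE; apply/asboolP.
Qed.

Lemma tpiD : {morph tpi : u v / u + v}.
Proof. by move=> u v; rewrite /tpi !piE. Qed.

Lemma tpiK (t : tens) : tpi (repr t) = t. Proof. exact: reprK. Qed.

Definition tscale (c : k) (t : tens) : tens := tpi (c *: repr t).

Lemma tpiZ c u : tscale c (tpi u) = tpi (c *: u).
Proof.
apply/tpi_eq; rewrite -scalerBr -[_ *: _]addr0; apply: trel_lin; last exact: trel_0.
by apply/tpi_eq; rewrite tpiK.
Qed.

Fact tscaleA a b t : tscale a (tscale b t) = tscale (a * b) t.
Proof. by rewrite -(tpiK t) !tpiZ scalerA. Qed.

Fact tscale1 : left_id 1 tscale.
Proof. by move=> t; rewrite -(tpiK t) !tpiZ scale1r. Qed.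

Fact tscaleDr : right_distributive tscale +%R.
Proof.
by move=> c t u; rewrite -(tpiK t) -(tpiK u) -tpiD !tpiZ -tpiD scalerDr.
Qed.

Fact tscaleDl t : {morph tscale^~ t : a b / a + b}.
Proof. by move=> a b /=; rewrite -(tpiK t) !tpiZ -tpiD scalerDl. Qed.

HB.instance Definition _ := GRing.Zmodule_isLmodule.Build k tens
  tscaleA tscale1 tscaleDr tscaleDl.

Fact tpi_linear : linear tpi.
Proof. by move=> c u v; rewrite tpiD -tpiZ. Qed.

HB.instance Definition _ := GRing.isLinear.Build k tfree tens *:%R tpi tpi_linear.

(* x (x) y. *)
Definition pure i j (e : (i + j)%N = n) (x : X i) (y : Y j) : tens :=
  tpi (fgen e x y).

Lemma purePl i j (e : (i + j)%N = n) (y : Y j) : linear (fun x => pure e x y).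
Proof.
by move=> c x x'; rewrite /pure -linearP; apply/tpi_eq; apply: trel_bill.
Qed.

Lemma purePr i j (e : (i + j)%N = n) (x : X i) : linear (pure e x).
Proof.
by move=> c y y'; rewrite /pure -linearP; apply/tpi_eq; apply: trel_bilr.
Qed.

Lemma pure0l i j (e : (i + j)%N = n) (y : Y j) : pure e (0 : X i) y = 0.
Proof. exact: (linear0 (mklinear (purePl e y))). Qed.

Lemma pure0r i j (e : (i + j)%N = n) (x : X i) : pure e x (0 : Y j) = 0.
Proof. exact: (linear0 (mklinear (purePr e x))). Qed.

Lemma pureZl i j (e : (i + j)%N = n) c (x : X i) (y : Y j) :
  pure e (c *: x) y = c *: pure e x y.
Proof. exact: (linearZ_LR (mklinear (purePl e y))). Qed.

Lemma pureZr i j (e : (i + j)%N = n) c (x : X i) (y : Y j) :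
  pure e x (c *: y) = c *: pure e x y.
Proof. exact: (linearZ_LR (mklinear (purePr e x))). Qed.

Lemma pureDl i j (e : (i + j)%N = n) (x x' : X i) (y : Y j) :
  pure e (x + x') y = pure e x y + pure e x' y.
Proof. exact: (linearD (mklinear (purePl e y))). Qed.

Lemma pureDr i j (e : (i + j)%N = n) (x : X i) (y y' : Y j) :
  pure e x (y + y') = pure e x y + pure e x y'.
Proof. exact: (linearD (mklinear (purePr e x))). Qed.

Lemma tens_ind (P : tens -> Prop) :
  P 0 -> (forall c u v, P u -> P v -> P (c *: u + v)) ->
  (forall i j e x y, P (@pure i j e x y)) -> forall t, P t.
Proof.
move=> P0 PD Pp t; rewrite -(tpiK t).
elim/freeg_ind_dom0: (repr t) => [|c g u _ _ Pu]; first by rewrite linear0.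
have -> : [freeg [:: (c, g)]] = c *: [freeg [:: (1, g)]] :> tfree.
  apply/eqP/freeg_eqP => z; rewrite coeffZ !coeffU mul1r.
  by [].
rewrite linearP; apply: PD => //.
case: g => -[[i x] [j y]] /= e.
have -> : exist _ (Tagged X x, Tagged Y y) e = tgen_of (elimT eqP e) x y.
  exact: val_inj.
exact: Pp.
Qed.

(* Families of bilinear maps X_i -> Y_j -> M, i + j = n; they correspond to the
   linear maps tens n -> M (see tlift, tlift_pure and tens_ext). *)
Record bilin (M : lmodType k) := Bilin {
  bilin_fun :> forall i j, (i + j)%N = n -> X i -> Y j -> M;
  bilinPl : forall i j e y, linear (fun x => @bilin_fun i j e x y);
  bilinPr : forall i j e x, linear (@bilin_fun i j e x)
}.

Section Lift.
Variables (M : lmodType k) (f : bilin M).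

Definition gen_lift (g : tgen) : M :=
  f _ _ (elimT eqP (valP g)) (tagged (val g).1) (tagged (val g).2).

Lemma gen_liftE i j e x y : gen_lift (@tgen_of i j e x y) = f i j e x y.
Proof. by rewrite /gen_lift /=; congr (f _ _ _ _ _); exact: eq_irrelevance. Qed.

Lemma fglift_linear : linear (fglift gen_lift : tfree -> M).
Proof.
have A := lift_is_additive gen_lift.
have A0 : fglift gen_lift (0 : tfree) = 0 by have := A 0 0; rewrite !subrr.
have AD u v : fglift gen_lift (u + v : tfree) = fglift gen_lift u + fglift gen_lift v.
  have AN w : fglift gen_lift (- w : tfree) = - fglift gen_lift w.
    by have := A 0 w; rewrite !sub0r A0 sub0r.
  by rewrite -[v in LHS]opprK A AN opprK.
move=> c u v; rewrite AD; congr (_ + _).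
elim/freeg_ind_dom0: u => [|a g u _ _ IHu]; first by rewrite scaler0 A0 scaler0.
have cE : c *: [freeg [:: (a, g)]] = [freeg [:: (c * a, g)]] :> tfree.
  by apply/eqP/freeg_eqP => z; rewrite coeffZ !coeffU mulrA.
by rewrite scalerDr cE !AD IHu !liftU scalerDr scalerA.
Qed.

HB.instance Definition _ :=
  GRing.isLinear.Build k tfree M *:%R (fglift gen_lift) fglift_linear.

Definition tlift_fun (t : tens) : M := fglift gen_lift (repr t : tfree).

Lemma fglift_fgen i j e x y : fglift gen_lift (@fgen i j e x y) = f i j e x y.
Proof. by rewrite liftU scale1r gen_liftE. Qed.

Lemma tlift_pi u : tlift_fun (tpi u) = fglift gen_lift u.
Proof.
have: trel (repr (tpi u) - u) by apply/tpi_eq; rewrite tpiK.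
move=> R0; apply/eqP; rewrite -subr_eq0 -linearB; apply/eqP.
elim: R0 => [i j e c x x' y|i j e c x y y'||c v w _ IHv _ IHw].
- by rewrite linearB linearP /= !fglift_fgen bilinPl subrr.
- by rewrite linearB linearP /= !fglift_fgen bilinPr subrr.
- exact: linear0.
- by rewrite linearP IHv IHw addr0 /= scaler0.
Qed.

Fact tlift_linear : linear tlift_fun.
Proof.
move=> c u v; rewrite -(tpiK u) -(tpiK v) -linearP !tlift_pi.
exact: fglift_linear.
Qed.

Definition tlift : {linear tens -> M} := mklinear tlift_linear.

Lemma tlift_pure i j e x y : tlift (@pure i j e x y) = f i j e x y.
Proof. by rewrite /= /linear_fun_of tlift_pi fglift_fgen. Qed.

End Lift.

Lemma tens_ext (M : lmodType k) (f g : {linear tens -> M}) :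
  (forall i j e x y, f (@pure i j e x y) = g (pure e x y)) -> f =1 g.
Proof.
move=> fg; apply: tens_ind => [|c u v fgu fgv|//]; first by rewrite !linear0.
by rewrite !linearP fgu fgv.
Qed.

End Degree.
End Tensor.

Section ChainComplexes.
Variable k : fieldType.

Record chain_complex := ChainComplex {
  cmod :> nat -> lmodType k;
  cd : forall n, {linear cmod n.+1 -> cmod n};
  cdd : forall n x, cd n (cd n.+1 x) = 0
}.

Record chain_map (X Y : chain_complex) := ChainMap {
  cmap :> forall n, {linear X n -> Y n};
  cmapd : forall n x, cmap n (cd X n x) = cd Y n (cmap n.+1 x)
}.

Lemma chain_map_ext (X Y : chain_complex) (f g : chain_map X Y) :
  (forall n x, f n x = g n x) -> f = g.
Proof.
case: f g => f fd [g gd] /= fg.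
have {}fg : f = g by apply: functional_extensionality_dep => n; exact/linear_ext/fg.
by subst g; rewrite (Prop_irrelevance fd gd).
Qed.

Definition chain_id X : chain_map X X :=
  @ChainMap X X (fun n => idfun : {linear X n -> X n}) (fun n x => erefl).

Fact chain_comp_subproof X Y Z (g : chain_map Y Z) (f : chain_map X Y) n x :
  (g n \o f n) (cd X n x) = cd Z n ((g n.+1 \o f n.+1) x).
Proof. by rewrite /= !cmapd. Qed.

Definition chain_comp X Y Z (g : chain_map Y Z) (f : chain_map X Y) :
  chain_map X Z :=
  @ChainMap X Z (fun n => g n \o f n : {linear X n -> Z n})
    (chain_comp_subproof g f).

Lemma chain_comp1 X Y (f : chain_map X Y) : chain_comp (chain_id Y) f = f.
Proof. exact: chain_map_ext. Qed.

Lemma chain_1comp X Y (f : chain_map X Y) : chain_comp f (chain_id X) = f.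
Proof. exact: chain_map_ext. Qed.

Lemma chain_compA X Y Z T (h : chain_map Z T) (g : chain_map Y Z)
    (f : chain_map X Y) :
  chain_comp h (chain_comp g f) = chain_comp (chain_comp h g) f.
Proof. exact: chain_map_ext. Qed.

Definition Ch : category := Category chain_comp1 chain_1comp chain_compA.

Section TensorComplex.
Variables X Y : chain_complex.

Definition dleft n i j :
    (i + j)%N = n.+1 -> X i -> Y j -> tens X Y n :=
  match i return (i + j)%N = n.+1 -> X i -> Y j -> tens X Y n with
  | 0 => fun _ _ _ => 0
  | i'.+1 => fun e x y => pure (succn_inj e) (cd X i' x) y
  end.

Definition dright n i j :
    (i + j)%N = n.+1 -> X i -> Y j -> tens X Y n :=
  match j return (i + j)%N = n.+1 -> X i -> Y j -> tens X Y n with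
  | 0 => fun _ _ _ => 0
  | j'.+1 => fun e x y =>
      pure (succn_inj (etrans (esym (addnS i j')) e)) x (cd Y j' y)
  end.

(* d(x (x) y) = dx (x) y + (-1)^|x| x (x) dy. *)
Definition tensor_d_fun n i j (e : (i + j)%N = n.+1) (x : X i) (y : Y j) :=
  dleft e x y + (-1) ^+ i *: dright e x y.

Fact tensor_d_funPl n i j e y :
  linear (fun x => @tensor_d_fun n i j e x y).
Proof.
move=> c x x'; rewrite /tensor_d_fun.
have -> : dleft e (c *: x + x') y = c *: dleft e x y + dleft e x' y.
  case: i e x x' => [|i] e x x' /=; first by rewrite scaler0 addr0.
  by rewrite linearP purePl.
have -> : dright e (c *: x + x') y = c *: dright e x y + dright e x' y.
  by case: j e y => [|j] e y /=; rewrite ?scaler0 ?addr0 // purePl.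
by rewrite !scalerDr !scalerA [c * _]mulrC addrACA.
Qed.

Fact tensor_d_funPr n i j e x :
  linear (@tensor_d_fun n i j e x).
Proof.
move=> c y y'; rewrite /tensor_d_fun.
have -> : dleft e x (c *: y + y') = c *: dleft e x y + dleft e x y'.
  by case: i e x => [|i] e x /=; rewrite ?scaler0 ?addr0 // purePr.
have -> : dright e x (c *: y + y') = c *: dright e x y + dright e x y'.
  case: j e y y' => [|j] e y y' /=; first by rewrite scaler0 addr0.
  by rewrite linearP purePr.
by rewrite !scalerDr !scalerA [c * _]mulrC addrACA.
Qed.

Definition tensor_d n : {linear tens X Y n.+1 -> tens X Y n} :=
  tlift (Bilin (@tensor_d_funPl n) (@tensor_d_funPr n)).

Lemma tensor_d_pure n i j e x y :
  tensor_d n (@pure _ X Y n.+1 i j e x y) =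
  dleft e x y + (-1) ^+ i *: dright e x y.
Proof. by rewrite /tensor_d tlift_pure. Qed.

Fact tensor_dd n t : tensor_d n (tensor_d n.+1 t) = 0.
Proof.
elim/tens_ind: t => [|c u v IHu IHv|i j e x y]; first by rewrite !linear0.
  by rewrite !linearP IHu IHv scaler0 addr0.
rewrite tensor_d_pure linearD linearZ /=.
case: i e x => [|i] e x; case: j e y => [|j] e y /=;
  rewrite ?linear0 ?scaler0 ?add0r ?addr0 //.
- rewrite tensor_d_pure /= add0r.
  case: j e y => [|j] e y /=; rewrite ?scaler0 //.
  by rewrite cdd pure0r !scaler0.
- rewrite tensor_d_pure /= scaler0 addr0.
  case: i e x => [|i] e x //=.
  by rewrite cdd pure0l.
- rewrite !tensor_d_pure /=.
  have -> : forall e', dleft (n := n) (i := i) (j := j.+1) e' (cd X i x) y = 0.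
    case: i e x => [|i] e x e' //=.
    by rewrite cdd pure0l.
  have -> : forall e', dright (n := n) (i := i.+1) (j := j) e' x (cd Y j y) = 0.
    case: j e y => [|j] e y e' //=.
    by rewrite cdd pure0r.
  rewrite add0r scaler0 addr0 exprS mulN1r scaleNr.
  set p := pure _ _ _; set q := pure _ _ _.
  suff -> : p = q by rewrite subrr.
  by rewrite /p /q; congr pure; exact: eq_irrelevance.
Qed.

Definition tensor : chain_complex := ChainComplex tensor_dd.

Lemma tensor_cd_pure n i j (e : (i + j)%N = n.+1) (x : X i) (y : Y j) :
  cd tensor n (pure e x y) = dleft e x y + (-1) ^+ i *: dright e x y.
Proof. exact: tensor_d_pure. Qed.

End TensorComplex.

Section TensorMap.
Variables (X X' Y Y' : chain_complex) (f : chain_map X X') (g : chain_map Y Y').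

Definition tmap_fun n i j (e : (i + j)%N = n) (x : X i) (y : Y j) :
  tensor X' Y' n := pure e (f i x) (g j y).

Fact tmap_funPl n i j e y : linear (fun x => @tmap_fun n i j e x y).
Proof. by move=> c x x'; rewrite /tmap_fun linearP purePl. Qed.

Fact tmap_funPr n i j e x : linear (@tmap_fun n i j e x).
Proof. by move=> c y y'; rewrite /tmap_fun linearP purePr. Qed.

Definition tmap n : {linear tensor X Y n -> tensor X' Y' n} :=
  tlift (Bilin (@tmap_funPl n) (@tmap_funPr n)).

Lemma tmap_pure n i j e x y :
  tmap n (@pure _ X Y n i j e x y) = pure e (f i x) (g j y).
Proof. by rewrite /tmap tlift_pure. Qed.

Fact tmapd n t : tmap n (cd (tensor X Y) n t) = cd (tensor X' Y') n (tmap n.+1 t).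
Proof.
elim/tens_ind: t => [|c u v IHu IHv|i j e x y]; first by rewrite !linear0.
  by rewrite !linearP IHu IHv.
rewrite tmap_pure /= !tensor_d_pure linearD linearZ_LR.
congr (_ + _ *: _).
  by case: i e x => [|i] e x /=; rewrite ?linear0 // tmap_pure cmapd.
by case: j e y => [|j] e y /=; rewrite ?linear0 // tmap_pure cmapd.
Qed.

Definition tensor_map : chain_map (tensor X Y) (tensor X' Y') := ChainMap tmapd.

End TensorMap.

Section Braiding.
Variables X Y : chain_complex.

(* x (x) y |-> (-1)^(|x||y|) y (x) x. *)
Definition braid_fun n i j (e : (i + j)%N = n) (x : X i) (y : Y j) :
  tensor Y X n := (-1) ^+ (i * j) *: pure (etrans (addnC j i) e) y x.

Fact braid_funPl n i j e y : linear (fun x => @braid_fun n i j e x y).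
Proof.
by move=> c x x'; rewrite /braid_fun purePr scalerDr !scalerA [c * _]mulrC.
Qed.

Fact braid_funPr n i j e x : linear (@braid_fun n i j e x).
Proof.
by move=> c y y'; rewrite /braid_fun purePl scalerDr !scalerA [c * _]mulrC.
Qed.

Definition braid n : {linear tensor X Y n -> tensor Y X n} :=
  tlift (Bilin (@braid_funPl n) (@braid_funPr n)).

Lemma braid_pure n i j e x y :
  braid n (@pure _ X Y n i j e x y) =
  (-1) ^+ (i * j) *: pure (etrans (addnC j i) e) y x.
Proof. by rewrite /braid tlift_pure. Qed.

Fact braidd n t :
  braid n (cd (tensor X Y) n t) = cd (tensor Y X) n (braid n.+1 t).
Proof.
elim/tens_ind: t => [|c u v IHu IHv|i j e x y]; first by rewrite !linear0.
  by rewrite !linearP IHu IHv.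
rewrite braid_pure linearZ_LR /= !tensor_d_pure linearD linearZ_LR addrC scalerDr.
congr (_ + _).
  case: j e y => [|j] e y /=; first by rewrite linear0 !scaler0.
  rewrite braid_pure scalerA -exprD -mulnS.
  by congr (_ *: pure _ _ _); exact: eq_irrelevance.
case: i e x => [|i] e x /=; first by rewrite linear0 !scaler0.
rewrite braid_pure scalerA -exprD mulSn addnAC addnn exprD -[X in X * _]signr_odd odd_double mul1r.
by congr (_ *: pure _ _ _); exact: eq_irrelevance.
Qed.

Definition braiding : chain_map (tensor X Y) (tensor Y X) := ChainMap braidd.

End Braiding.

Section Associator.
Variables X Y Z : chain_complex.

Fact assoc_deg n i j a b :
  (a + b)%N = i -> (i + j)%N = n -> (a + (b + j))%N = n.
Proof. by move=> <- <-; exact: addnA. Qed.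

Section Inner.
Variables (n i j : nat) (e : (i + j)%N = n) (z : Z j).

Definition assoc_in_fun a b (e' : (a + b)%N = i) (x : X a) (y : Y b) :
    tensor X (tensor Y Z) n :=
  pure (Y := tensor Y Z) (assoc_deg e' e) x (pure erefl y z).

Fact assoc_in_funPl a b e' y : linear (fun x => @assoc_in_fun a b e' x y).
Proof. by move=> c x x'; rewrite /assoc_in_fun purePl. Qed.

Fact assoc_in_funPr a b e' x : linear (@assoc_in_fun a b e' x).
Proof. by move=> c y y'; rewrite /assoc_in_fun purePl purePr. Qed.

Definition assoc_in : {linear tensor X Y i -> tensor X (tensor Y Z) n} :=
  tlift (Bilin assoc_in_funPl assoc_in_funPr).

End Inner.

(* (x (x) y) (x) z |-> x (x) (y (x) z). *)
Definition assoc_fun n i j (e : (i + j)%N = n) (t : tensor X Y i) (z : Z j) :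
  tensor X (tensor Y Z) n := assoc_in e z t.

Fact assoc_funPl n i j e z : linear (fun t => @assoc_fun n i j e t z).
Proof. by move=> c t u; rewrite /assoc_fun linearP. Qed.

Fact assoc_funPr n i j e t : linear (@assoc_fun n i j e t).
Proof.
move=> c z z'; rewrite /assoc_fun.
elim/tens_ind: t => [|a u v IHu IHv|a b e' x y].
- by rewrite !linear0 addr0.
- by rewrite !linearP IHu IHv !scalerDr !scalerA [a * _]mulrC addrACA.
- by rewrite !tlift_pure /= /assoc_in_fun !purePr.
Qed.

Definition assoc n :
    {linear tensor (tensor X Y) Z n -> tensor X (tensor Y Z) n} :=
  tlift (Bilin (@assoc_funPl n) (@assoc_funPr n)).

Lemma assoc_pure n i j e a b e' x y z :
  assoc n (@pure _ (tensor X Y) Z n i j e (@pure _ X Y i a b e' x y) z) =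
  pure (Y := tensor Y Z) (assoc_deg e' e) x (pure erefl y z).
Proof. by rewrite /assoc !tlift_pure /= /assoc_fun tlift_pure. Qed.

Lemma pure_assocE n a b j m (e1 : (b + j)%N = m) (e2 : (a + m)%N = n) e3
    (x : X a) (y : Y b) (z : Z j) :
  pure (Y := tensor Y Z) e2 x (pure e1 y z) = pure (Y := tensor Y Z) e3 x (pure erefl y z).
Proof. by subst m; congr pure; exact: eq_irrelevance. Qed.

Section AssocD.
Variables (n a b j : nat) (e3 : (a + (b + j))%N = n.+1).
Variables (x : X a) (y : Y b) (z : Z j).

Definition dyz : tensor X (tensor Y Z) n :=
  match b return (a + (b + j))%N = n.+1 -> Y b -> tensor X (tensor Y Z) n with
  | 0 => fun _ _ => 0
  | b'.+1 => fun e y =>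
      pure (Y := tensor Y Z) (succn_inj (etrans (esym (addnS a (b' + j))) e))
        x (pure erefl (cd Y b' y) z)
  end e3 y.

Fact ydz_deg j' : (a + (b + j'.+1))%N = n.+1 -> (a + (b + j'))%N = n.
Proof. by rewrite !addnS => -[]. Qed.

Definition ydz : tensor X (tensor Y Z) n :=
  match j return (a + (b + j))%N = n.+1 -> Z j -> tensor X (tensor Y Z) n with
  | 0 => fun _ _ => 0
  | j'.+1 => fun e z =>
      pure (Y := tensor Y Z) (ydz_deg e) x (pure erefl y (cd Z j' z))
  end e3 z.

End AssocD.
Arguments dyz {n a b j}.
Arguments ydz {n a b j}.

Lemma assoc_dleft n a b j (e3 : (a + (b + j))%N = n.+1) (x : X a) (y : Y b) (z : Z j)
    i (e : (i + j)%N = n.+1) (e' : (a + b)%N = i) :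
  assoc n (dleft (X := tensor X Y) e (pure e' x y) z) =
  dleft (Y := tensor Y Z) e3 x (pure erefl y z) + (-1) ^+ a *: dyz e3 x y z.
Proof.
rewrite /dyz; case: i e e' => [|i] e e'.
  case: a e3 e' x => [|a] e3' e'' x' //.
  case: b e3' e'' y => [|b] e3' e'' y' //.
  by rewrite /= linear0 scaler0 addr0.
rewrite /= tensor_d_pure pureDl pureZl linearD linearZ_LR; congr (_ + _ *: _).
  case: a e3 e' x => [|a'] e3' e'' x' /=; first by rewrite pure0l linear0.
  by rewrite assoc_pure; congr pure; exact: eq_irrelevance.
case: b e3 e' y => [|b'] e3' e'' y' /=; first by rewrite pure0l linear0.
by rewrite assoc_pure; congr pure; exact: eq_irrelevance.
Qed.

Lemma assoc_dright n a b j (e3 : (a + (b + j))%N = n.+1) (x : X a) (y : Y b) (z : Z j)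
    i (e : (i + j)%N = n.+1) (e' : (a + b)%N = i) :
  assoc n (dright (X := tensor X Y) e (pure e' x y) z) = ydz e3 x y z.
Proof.
rewrite /ydz; case: j e3 e z => [|j'] e3' e'' z' /=; first by rewrite linear0.
by rewrite assoc_pure; congr pure; exact: eq_irrelevance.
Qed.

Lemma dright_assoc n a b j (e3 : (a + (b + j))%N = n.+1) (x : X a) (y : Y b) (z : Z j)
    m (e1 : (b + j)%N = m) (e2 : (a + m)%N = n.+1) :
  dright (Y := tensor Y Z) e2 x (pure e1 y z) = dyz e3 x y z + (-1) ^+ b *: ydz e3 x y z.
Proof.
rewrite /dyz /ydz; case: m e1 e2 => [|m] e1 e2.
  case: b e3 e1 y => [|b] e3' e1' y' //.
  case: j e3' e1' z => [|j] e3' e1' z' //.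
  by rewrite /= scaler0 addr0.
rewrite /= tensor_d_pure pureDr pureZr; congr (_ + _ *: _).
  case: b e3 e1 y => [|b'] e3' e1' y' /=; first by rewrite pure0r.
  exact: pure_assocE.
case: j e3 e1 z => [|j'] e3' e1' z' /=; first by rewrite pure0r.
exact: pure_assocE.
Qed.

Fact assocd n t :
  assoc n (cd (tensor (tensor X Y) Z) n t) =
  cd (tensor X (tensor Y Z)) n (assoc n.+1 t).
Proof.
elim/tens_ind: t => [|c u v IHu IHv|i j e t z]; first by rewrite !linear0.
  by rewrite !linearP IHu IHv.
elim/tens_ind: t => [|c u v IHu IHv|a b e' x y].
- by rewrite pure0l !linear0.
- by rewrite purePl !linearP IHu IHv.
rewrite assoc_pure [in LHS]tensor_cd_pure tensor_cd_pure linearD linearZ_LR.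
rewrite (assoc_dleft (assoc_deg e' e)) (assoc_dright (assoc_deg e' e)).
rewrite (dright_assoc (assoc_deg e' e)) scalerDr scalerA -exprD e' addrA.
by [].
Qed.

Definition associator :
    chain_map (tensor (tensor X Y) Z) (tensor X (tensor Y Z)) :=
  ChainMap assocd.

End Associator.

Section Unit.

(* k concentrated in degree 0. *)
Definition unit_mod (n : nat) : lmodType k :=
  if n is 0 then k^o else 'rV[k]_0.

Definition unit_complex : chain_complex :=
  @ChainComplex unit_mod (fun n => \0 : {linear unit_mod n.+1 -> unit_mod n})
    (fun _ _ => erefl).

Variable X : chain_complex.

(* The inverses x |-> 1 (x) x and x |-> x (x) 1 of the unit isomorphisms. *)
Definition lunit_inv_lin n : {linear X n -> tensor unit_complex X n} :=
  mklinear (purePr (X := unit_complex) (add0n n) (1 : k^o)).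

Definition runit_inv_lin n : {linear X n -> tensor X unit_complex n} :=
  mklinear (purePl (Y := unit_complex) (addn0 n) (1 : k^o)).

Fact lunit_invd n x :
  lunit_inv_lin n (cd X n x) =
  cd (tensor unit_complex X) n (lunit_inv_lin n.+1 x).
Proof.
apply: etrans (esym (tensor_cd_pure (X := unit_complex) (add0n n.+1) (1 : k^o) x)).
rewrite /= add0r expr0 scale1r.
by congr pure; exact: eq_irrelevance.
Qed.

Fact runit_invd n x :
  runit_inv_lin n (cd X n x) =
  cd (tensor X unit_complex) n (runit_inv_lin n.+1 x).
Proof.
apply: etrans (esym (tensor_cd_pure (Y := unit_complex) (addn0 n.+1) x (1 : k^o))).
rewrite /= scaler0 addr0.
by congr pure; exact: eq_irrelevance.
Qed.

Definition lunit_inv : chain_map X (tensor unit_complex X) :=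
  ChainMap lunit_invd.

Definition runit_inv : chain_map X (tensor X unit_complex) :=
  ChainMap runit_invd.

End Unit.

Lemma tensor_map_comp X X' X'' Y Y' Y'' (f' : chain_map X' X'')
    (f : chain_map X X') (g' : chain_map Y' Y'') (g : chain_map Y Y') :
  tensor_map (chain_comp f' f) (chain_comp g' g) =
  chain_comp (tensor_map f' g') (tensor_map f g).
Proof.
apply: chain_map_ext => n; apply: tens_ext => i j e x y.
by rewrite /= !tmap_pure.
Qed.

Lemma tensor_map1 X Y :
  tensor_map (chain_id X) (chain_id Y) = chain_id (tensor X Y).
Proof.
apply: chain_map_ext => n; apply: tens_ext => i j e x y.
by rewrite /= !tmap_pure.
Qed.

Record cdgc := Cdgc {
  coalg_complex :> chain_complex;
  comul : chain_map coalg_complex (tensor coalg_complex coalg_complex);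
  counit : chain_map coalg_complex unit_complex;
  comulA :
    chain_comp (associator _ _ _)
      (chain_comp (tensor_map comul (chain_id _)) comul) =
    chain_comp (tensor_map (chain_id _) comul) comul;
  counitl :
    chain_comp (tensor_map counit (chain_id _)) comul = lunit_inv _;
  counitr :
    chain_comp (tensor_map (chain_id _) counit) comul = runit_inv _;
  comulC : chain_comp (braiding _ _) comul = comul
}.

Record cdgc_map (C D : cdgc) := CdgcMap {
  coalg_map :> chain_map C D;
  coalg_map_comul :
    chain_comp (comul D) coalg_map =
    chain_comp (tensor_map coalg_map coalg_map) (comul C);
  coalg_map_counit : chain_comp (counit D) coalg_map = counit C
}.

Lemma cdgc_map_ext (C D : cdgc) (f g : cdgc_map C D) :
  coalg_map f = coalg_map g -> f = g.
Proof.
case: f g => f f1 f2 [g g1 g2] /= fg; subst g.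
by rewrite (Prop_irrelevance f1 g1) (Prop_irrelevance f2 g2).
Qed.

Fact cdgc_id_comul C :
  chain_comp (comul C) (chain_id C) =
  chain_comp (tensor_map (chain_id C) (chain_id C)) (comul C).
Proof. by rewrite tensor_map1 chain_comp1 chain_1comp. Qed.

Definition cdgc_id C : cdgc_map C C :=
  CdgcMap (cdgc_id_comul C) (chain_1comp (counit C)).

Section Comp.
Variables (C D E : cdgc) (g : cdgc_map D E) (f : cdgc_map C D).

Fact cdgc_comp_comul :
  chain_comp (comul E) (chain_comp g f) =
  chain_comp (tensor_map (chain_comp g f) (chain_comp g f)) (comul C).
Proof.
by rewrite tensor_map_comp chain_compA coalg_map_comul -!chain_compA
  coalg_map_comul.
Qed.

Fact cdgc_comp_counit : chain_comp (counit E) (chain_comp g f) = counit C.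
Proof. by rewrite chain_compA !coalg_map_counit. Qed.

Definition cdgc_comp : cdgc_map C E := CdgcMap cdgc_comp_comul cdgc_comp_counit.

End Comp.

Lemma cdgc_comp1 C D (f : cdgc_map C D) : cdgc_comp (cdgc_id D) f = f.
Proof. exact/cdgc_map_ext/chain_comp1. Qed.

Lemma cdgc_1comp C D (f : cdgc_map C D) : cdgc_comp f (cdgc_id C) = f.
Proof. exact/cdgc_map_ext/chain_1comp. Qed.

Lemma cdgc_compA C D E F (h : cdgc_map E F) (g : cdgc_map D E)
    (f : cdgc_map C D) :
  cdgc_comp h (cdgc_comp g f) = cdgc_comp (cdgc_comp h g) f.
Proof. exact/cdgc_map_ext/chain_compA. Qed.

Definition CDGC : category := Category cdgc_comp1 cdgc_1comp cdgc_compA.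

Definition forgetful : functor CDGC Ch :=
  @Functor CDGC Ch coalg_complex coalg_map (fun _ => erefl)
    (fun _ _ _ _ _ => erefl).

End ChainComplexes.

(* Main.v *)
(* Over a field every element of a dg coalgebra C lies in a countably generated
   sub dg coalgebra: start from the element and keep adjoining differentials and
   the tensor factors of coproducts.  The inclusion j of such a subspace has a
   linear retraction, so j (x) j is injective and the structure of C restricts.
   Countably generated modules are, up to isomorphism, quotients of the free
   module on nat, so the coalgebras of this form equipped with a chain map to X
   are indexed by a small type.  The colimit of all of them is the cofree
   coalgebra on X: any C over X is covered by its countably generated
   subcoalgebras, any two of which lie in a third. *)
From HB Require Import structures.
Require Import Defs.
From mathcomp Require Import all_boot all_algebra.
From mathcomp Require Import boolp classical_sets.
From mathcomp Require Import freeg.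

Set Implicit Arguments.
Unset Strict Implicit.
Unset Printing Implicit Defensive.

Import GRing.Theory.

Local Open Scope ring_scope.
Local Open Scope quotient_scope.

(** * Quotients of modules by spans of relations *)

Section Quotient.
Variables (k : fieldType) (V : lmodType k) (R : V -> Prop).

Inductive lspan : V -> Prop :=
| lspan_gen u of R u : lspan u
| lspan_0 : lspan 0
| lspan_lin c u v of lspan u & lspan v : lspan (c *: u + v).

Definition qker (u : V) : bool := `[< lspan u >].

Lemma qker_zmod_closed : zmod_closed qker.
Proof.
split=> [|u v /asboolP Ru /asboolP Rv]; apply/asboolP; first exact: lspan_0.
by rewrite -scaleN1r addrC; apply: lspan_lin.
Qed.

HB.instance Definition _ := GRing.isZmodClosed.Build V qker qker_zmod_closed.

Definition quot : Type := {ideal_quot (GRing.ZmodClosed.clone _ qker _)}.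

HB.instance Definition _ := GRing.Zmodule.on quot.
HB.instance Definition _ := EqQuotient.on quot.

Definition qpi (u : V) : quot := \pi_quot u.

Lemma qpiK (t : quot) : qpi (repr t) = t. Proof. exact: reprK. Qed.

Lemma qpi_eq u v : qpi u = qpi v <-> lspan (u - v).
Proof.
rewrite /qpi; split=> [/eqP|Ruv].
  by rewrite -Quotient.idealrBE => /asboolP.
by apply/eqP; rewrite -Quotient.idealrBE; apply/asboolP.
Qed.

Lemma qpiD : {morph qpi : u v / u + v}.
Proof. by move=> u v; rewrite /qpi !piE. Qed.

Definition qscale (c : k) (t : quot) : quot := qpi (c *: repr t).

Lemma qpiZ c u : qscale c (qpi u) = qpi (c *: u).
Proof.
apply/qpi_eq; rewrite -scalerBr -[_ *: _]addr0.
by apply: lspan_lin; [apply/qpi_eq; rewrite qpiK | exact: lspan_0].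
Qed.

Fact qscaleA a b t : qscale a (qscale b t) = qscale (a * b) t.
Proof. by rewrite -(qpiK t) !qpiZ scalerA. Qed.

Fact qscale1 : left_id 1 qscale.
Proof. by move=> t; rewrite -(qpiK t) !qpiZ scale1r. Qed.

Fact qscaleDr : right_distributive qscale +%R.
Proof.
by move=> c t u; rewrite -(qpiK t) -(qpiK u) -qpiD !qpiZ -qpiD scalerDr.
Qed.

Fact qscaleDl t : {morph qscale^~ t : a b / a + b}.
Proof. by move=> a b /=; rewrite -(qpiK t) !qpiZ -qpiD scalerDl. Qed.

HB.instance Definition _ := GRing.Zmodule_isLmodule.Build k quot
  qscaleA qscale1 qscaleDr qscaleDl.

Fact qpi_linear : linear qpi.
Proof. by move=> c u v; rewrite qpiD -qpiZ. Qed.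

HB.instance Definition _ := GRing.isLinear.Build k V quot *:%R qpi qpi_linear.

Section Lift.
Variables (M : lmodType k) (f : {linear V -> M}).
Hypothesis fR : forall u, R u -> f u = 0.

Lemma lspan_lift u : lspan u -> f u = 0.
Proof.
by elim=> [//||c v w _ fv _ fw]; rewrite ?linear0 // linearP fv fw scaler0 addr0.
Qed.

Definition qlift_fun (t : quot) : M := f (repr t).

Lemma qlift_fun_pi u : qlift_fun (qpi u) = f u.
Proof.
(* The chosen representative of the class of [u] differs from [u] by an element of the span, where
   [f] vanishes. *)
have /qpi_eq/lspan_lift : qpi (repr (qpi u)) = qpi u by rewrite qpiK.
by rewrite linearB => /eqP; rewrite subr_eq0 => /eqP.
Qed.

Fact qlift_linear : linear qlift_fun.
Proof.
move=> c u v; rewrite -(qpiK u) -(qpiK v) -linearP !qlift_fun_pi.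
exact: linearP.
Qed.

Definition qlift : {linear quot -> M} := mklinear qlift_linear.

Lemma qlift_pi u : qlift (qpi u) = f u.
Proof. exact: qlift_fun_pi. Qed.

End Lift.
End Quotient.

(** * Modules by generators and relations *)

Section Presentation.
Variables (k : fieldType) (G : choiceType).

Definition fg : lmodType k := {freeg G / k}.
Definition fgU (g : G) : fg := [freeg [:: (1, g)]].

Lemma fg_ind (P : fg -> Prop) :
  P 0 -> (forall c u v, P u -> P v -> P (c *: u + v)) ->
  (forall g, P (fgU g)) -> forall u, P u.
Proof.
move=> P0 PD Pg; elim/freeg_ind_dom0 => [//|c g u _ _ Pu].
have -> : [freeg [:: (c, g)]] = c *: fgU g :> fg.
  by apply/eqP/freeg_eqP => z; rewrite coeffZ !coeffU mul1r.
exact: PD.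
Qed.

Section FgLift.
Variables (M : lmodType k) (h : G -> M).

Fact fglift_is_linear : linear (fglift h : fg -> M).
Proof.
pose f : fg -> M := fglift h.
have fB u v : f (u - v) = f u - f v := lift_is_additive h u v.
have f0 : f 0 = 0 by have := fB 0 0; rewrite !subrr.
have fD u v : f (u + v) = f u + f v.
  by rewrite -[v in LHS]opprK fB -[- v]sub0r fB f0 sub0r opprK.
move=> c u v; rewrite -/f fD; congr (_ + _).
elim/freeg_ind_dom0: u => [|a g u _ _ IHu]; first by rewrite scaler0 f0 scaler0.
have cE : c *: [freeg [:: (a, g)]] = [freeg [:: (c * a, g)]] :> fg.
  by apply/eqP/freeg_eqP => z; rewrite coeffZ !coeffU mulrA.
by rewrite scalerDr cE !fD IHu /f !liftU scalerDr scalerA.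
Qed.

Definition fgl : {linear fg -> M} := mklinear fglift_is_linear.

Lemma fgl_U g : fgl (fgU g) = h g.
Proof. by rewrite /= /linear_fun_of liftU scale1r. Qed.

End FgLift.

Variable R : fg -> Prop.

Definition pres : lmodType k := quot R.
Definition pgen (g : G) : pres := qpi R (fgU g).

Lemma pres_ind (P : pres -> Prop) :
  P 0 -> (forall c u v, P u -> P v -> P (c *: u + v)) ->
  (forall g, P (pgen g)) -> forall u, P u.
Proof.
move=> P0 PD Pg t; rewrite -(qpiK t).
elim/fg_ind: (repr t) => [|c u v Pu Pv|//]; first by rewrite linear0.
by rewrite linearP; exact: PD.
Qed.

Lemma pres_ext (M : lmodType k) (f g : {linear pres -> M}) :
  (forall x, f (pgen x) = g (pgen x)) -> f =1 g.
Proof.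
move=> fg; apply: pres_ind => [|c u v fgu fgv|//]; first by rewrite !linear0.
by rewrite !linearP fgu fgv.
Qed.

Lemma pres_lift (M : lmodType k) (h : G -> M) :
  (forall u, R u -> fgl h u = 0) ->
  {f : {linear pres -> M} | forall g, f (pgen g) = h g}.
Proof. by move=> hR; exists (qlift hR) => g; rewrite qlift_pi fgl_U. Qed.

End Presentation.

(** * Splitting of injections between vector spaces *)

Section Retraction.
Variable k : fieldType.

Lemma linear_retraction (V W : lmodType k) (g : {linear V -> W}) :
  injective g -> {r : {linear W -> V} | cancel g r}.
Proof.
(* A maximal subspace [A] meeting [g V] trivially is a complement of [g V]. *)
move=> g_inj; apply: cid.
have gE v : g v = 0 -> v = 0 by move=> gv; apply: g_inj; rewrite linear0.
(* [P] lets the empty set through, as [Zorn_bigcup] requires. *)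
pose P (A : set W) := (forall c u v, A u -> A v -> A (c *: u + v)) /\
  (forall v, A (g v) -> v = 0).
have [A [[Alin A0] Amax]] : exists A, P A /\ forall B, (A `<` B)%classic -> ~ P B.
  apply: Zorn_bigcup => F FP Ftot; split=> [c u v [B FB Bu] [C FC Cv]|v [B FB Bv]].
    have [BC|CB] := Ftot _ _ FB FC.
      by exists C => //; apply: (FP _ FC).1 => //; exact: BC.
    by exists B => //; apply: (FP _ FB).1 => //; exact: CB.
  exact: (FP _ FB).2 Bv.
(* A maximal set without 0 would be empty, since 0 = -u + u for any u in it; but [{0}] is a larger
   admissible set. *)
have AZ0 : A 0.
  apply: contrapT => nA0; have A_empty u : ~ A u.
    by move=> Au; apply: nA0; rewrite -[0](addNr u) -scaleN1r; exact: Alin.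
  apply: (Amax [set 0]%classic); first split=> [u /A_empty //|/(_ 0 erefl)//].
  by split=> [c u v /= -> ->|v /=]; [rewrite scaler0 addr0 | exact: gE].
have AZ c u : A u -> A (c *: u) by move=> Au; rewrite -[_ *: _]addr0; exact: Alin.
have AD u v : A u -> A v -> A (u + v) by move=> Au; rewrite -[u]scale1r; exact: Alin.
(* If x were outside [A + g V], then [A + kx] would be strictly larger and still meet [g V]
   trivially: a relation [g v = c x + w] with c nonzero puts [x - g (c^-1 v)] in [A]. *)
have ex x : exists v, A (x - g v).
  apply: contrapT => nex.
  apply: (Amax [set u | exists c w, A w /\ u = c *: x + w]%classic).
    split=> [u Au|/(_ x)]; first by exists 0, u; rewrite scale0r add0r.
    move=> AB; apply: nex; exists 0; rewrite linear0 subr0; apply: AB.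
    by exists 1, 0; rewrite scale1r addr0.
  split=> [c _ _ [a [w [Aw ->]]] [b [z [Az ->]]]|v [c [w [Aw gvE]]]].
    exists (c * a + b), (c *: w + z); split; first exact: Alin.
    by rewrite scalerDr scalerDl scalerA addrACA.
  have [c0|c0] := eqVneq c 0; first by apply: A0; rewrite gvE c0 scale0r add0r.
  case: nex; exists (c^-1 *: v); rewrite linearZ_LR gvE scalerDr scalerA mulVf //.
  by rewrite scale1r opprD addNKr -scaleNr; exact: AZ.
pose r x := sval (cid (ex x)).
have rP x : A (x - g (r x)) by rewrite /r; case: cid.
(* The component along [g V] is unique, so the chosen [r] is linear and inverts [g]. *)
have rE x v : A (x - g v) -> r x = v.
  move=> Av; apply/eqP; rewrite -subr_eq0; apply/eqP/A0.
  have -> : g (r x - v) = (- 1) *: (x - g (r x)) + (x - g v).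
    by rewrite linearB scaleN1r opprB addrA subrK.
  exact: Alin.
have r_lin : linear r.
  move=> c u v; apply: rE; rewrite linearP /=.
  have -> : c *: u + v - (c *: g (r u) + g (r v)) =
            c *: (u - g (r u)) + (v - g (r v)).
    by rewrite scalerBr opprD addrACA.
  exact: Alin.
by exists (mklinear r_lin) => v; apply: rE; rewrite subrr.
Qed.

End Retraction.

(** * Tensor products of injective maps *)

Section GradedTensorMap.
Variable k : fieldType.

Section Def.
Variables (X X' Y Y' : nat -> lmodType k).
Variables (f : forall n, {linear X n -> X' n}) (g : forall n, {linear Y n -> Y' n}).
Variable n : nat.

(** The formula of [tmap_fun] for maps that are only degreewise linear: a retraction of a chain map
    need not commute with differentials. *)
Definition gtmap_fun i j (e : (i + j)%N = n) (x : X i) (y : Y j) :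
  tens X' Y' n := pure e (f i x) (g j y).

Fact gtmap_funPl i j e y : linear (fun x => @gtmap_fun i j e x y).
Proof. by move=> c x x'; rewrite /gtmap_fun linearP purePl. Qed.

Fact gtmap_funPr i j e x : linear (@gtmap_fun i j e x).
Proof. by move=> c y y'; rewrite /gtmap_fun linearP purePr. Qed.

Definition gtmap : {linear tens X Y n -> tens X' Y' n} :=
  tlift (Bilin gtmap_funPl gtmap_funPr).

Lemma gtmap_pure i j e x y :
  gtmap (@pure _ X Y n i j e x y) = pure e (f i x) (g j y).
Proof. by rewrite /gtmap tlift_pure. Qed.

End Def.

Lemma gtmapK (X X' Y Y' : nat -> lmodType k)
    (f : forall n, {linear X n -> X' n}) (g : forall n, {linear Y n -> Y' n})
    (f' : forall n, {linear X' n -> X n}) (g' : forall n, {linear Y' n -> Y n}) :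
  (forall n, cancel (f n) (f' n)) -> (forall n, cancel (g n) (g' n)) ->
  forall n, cancel (gtmap f g n) (gtmap f' g' n).
Proof.
move=> fK gK n; elim/tens_ind => [|c u v IHu IHv|i j e x y].
- by rewrite !linear0.
- by rewrite !linearP IHu IHv.
- by rewrite !gtmap_pure fK gK.
Qed.

(** Degreewise retractions of [f] and [g] tensor to a retraction of [gtmap f g]. *)
Lemma gtmap_inj (X X' Y Y' : nat -> lmodType k)
    (f : forall n, {linear X n -> X' n}) (g : forall n, {linear Y n -> Y' n}) :
  (forall n, injective (f n)) -> (forall n, injective (g n)) ->
  forall n, injective (gtmap f g n).
Proof.
move=> f_inj g_inj n.
exact: can_inj (gtmapK (fun i => svalP (linear_retraction (@f_inj i)))
                       (fun i => svalP (linear_retraction (@g_inj i))) (n := n)).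
Qed.

Lemma tensor_mapE (X X' Y Y' : chain_complex k) (f : chain_map X X')
    (g : chain_map Y Y') n t : tensor_map f g n t = gtmap f g n t.
Proof. by apply: tens_ext => i j e x y; rewrite gtmap_pure /= tmap_pure. Qed.

Lemma tensor_map_inj (X X' Y Y' : chain_complex k) (f : chain_map X X')
    (g : chain_map Y Y') :
  (forall n, injective (f n)) -> (forall n, injective (g n)) ->
  forall n, injective (tensor_map f g n).
Proof. by move=> fI gI n x y; rewrite !tensor_mapE; exact: gtmap_inj. Qed.

End GradedTensorMap.

(** * Naturality of associator, braiding and unit maps *)

Section Naturality.
Variable k : fieldType.

Lemma chain_compE (X Y Z : chain_complex k) (g : chain_map Y Z)
    (f : chain_map X Y) n x : chain_comp g f n x = g n (f n x).
Proof. by []. Qed.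

Lemma tensor_map_pure (X X' Y Y' : chain_complex k) (f : chain_map X X')
    (g : chain_map Y Y') n i j (e : (i + j)%N = n) (x : X i) (y : Y j) :
  tensor_map f g n (pure e x y) = pure e (f i x) (g j y).
Proof. exact: tmap_pure. Qed.

Lemma associator_pure (X Y Z : chain_complex k) n i j (e : (i + j)%N = n) a b
    (e' : (a + b)%N = i) (x : X a) (y : Y b) (z : Z j) :
  associator X Y Z n (pure (X := tensor X Y) e (pure e' x y) z) =
  pure (Y := tensor Y Z) (assoc_deg e' e) x (pure erefl y z).
Proof. exact: assoc_pure. Qed.

Lemma braiding_pure (X Y : chain_complex k) n i j (e : (i + j)%N = n)
    (x : X i) (y : Y j) :
  braiding X Y n (pure e x y) = (-1) ^+ (i * j) *: pure (etrans (addnC j i) e) y x.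
Proof. exact: braid_pure. Qed.

Lemma associator_nat (X X' Y Y' Z Z' : chain_complex k) (f : chain_map X X')
    (g : chain_map Y Y') (h : chain_map Z Z') :
  chain_comp (associator _ _ _) (tensor_map (tensor_map f g) h) =
  chain_comp (tensor_map f (tensor_map g h)) (associator _ _ _).
Proof.
apply: chain_map_ext => n; apply: tens_ext => i j e t z.
rewrite !chain_compE tensor_map_pure.
elim/tens_ind: t => [|c u v IHu IHv|a b e' x y].
- by rewrite linear0 !pure0l !linear0.
- by rewrite linearP !purePl !linearP IHu IHv.
- by rewrite tensor_map_pure !associator_pure !tensor_map_pure.
Qed.

Lemma braiding_nat (X X' Y Y' : chain_complex k) (f : chain_map X X')
    (g : chain_map Y Y') :
  chain_comp (braiding _ _) (tensor_map f g) =
  chain_comp (tensor_map g f) (braiding _ _).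
Proof.
apply: chain_map_ext => n; apply: tens_ext => i j e x y.
by rewrite !chain_compE tensor_map_pure !braiding_pure linearZ_LR tensor_map_pure.
Qed.

Lemma lunit_inv_nat (X Y : chain_complex k) (f : chain_map X Y) :
  chain_comp (lunit_inv Y) f =
  chain_comp (tensor_map (chain_id _) f) (lunit_inv X).
Proof.
apply: chain_map_ext => n x; rewrite !chain_compE.
exact: esym (tensor_map_pure (chain_id (unit_complex k)) f (add0n n) (1 : k^o) x).
Qed.

Lemma runit_inv_nat (X Y : chain_complex k) (f : chain_map X Y) :
  chain_comp (runit_inv Y) f =
  chain_comp (tensor_map f (chain_id _)) (runit_inv X).
Proof.
apply: chain_map_ext => n x; rewrite !chain_compE.
exact: esym (tensor_map_pure f (chain_id (unit_complex k)) (addn0 n) x (1 : k^o)).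
Qed.

End Naturality.

(** * Transport of coalgebra laws and subcoalgebras *)

Section Coalgebra.
Variable k : fieldType.

(** Compose [h] with a retraction of [j], which inverts [j] on its image. *)
Lemma linear_factor (U V W : lmodType k) (j : {linear V -> W}) (h : {linear U -> W}) :
  injective j -> (forall x, exists y, j y = h x) ->
  {l : {linear U -> V} | forall x, j (l x) = h x}.
Proof.
move=> /linear_retraction[r rK] ex; exists (r \o h) => x /=.
by have [y <-] := ex x; rewrite rK.
Qed.

(** The degreewise factorizations commute with differentials, as one sees after applying the
    injective [j]. *)
Lemma chain_factor (X Y Z : chain_complex k) (j : chain_map Y Z) (h : chain_map X Z) :
  (forall n, injective (j n)) -> (forall n x, exists y, j n y = h n x) ->
  {l : chain_map X Y | chain_comp j l = h}.
Proof.
move=> j_inj ex; pose l n := sval (linear_factor (@j_inj n) (ex n)).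
have lE n x : j n (l n x) = h n x by rewrite /l; case: linear_factor.
have ld n x : l n (cd X n x) = cd Y n (l n.+1 x).
  by apply: (@j_inj n); rewrite lE !cmapd lE.
by exists (ChainMap ld); apply: chain_map_ext => n x; exact: lE.
Qed.

Section Laws.
Variables (A : chain_complex k) (D : chain_map A (tensor A A)).
Variable e : chain_map A (unit_complex k).

(** The composites occurring in the laws are named so that each can be proved natural before any law
    is known. *)
Definition coassl := chain_comp (associator A A A)
  (chain_comp (tensor_map D (chain_id A)) D).
Definition coassr := chain_comp (tensor_map (chain_id A) D) D.
Definition counl := chain_comp (tensor_map e (chain_id A)) D.
Definition counr := chain_comp (tensor_map (chain_id A) e) D.
Definition coswap := chain_comp (braiding A A) D.

Record coalg_laws : Prop := CoalgLaws {
  coalg_assoc : coassl = coassr;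
  coalg_unitl : counl = lunit_inv A;
  coalg_unitr : counr = runit_inv A;
  coalg_swap : coswap = D
}.

Definition cdgc_of (L : coalg_laws) : cdgc k :=
  @Cdgc k A D e (coalg_assoc L) (coalg_unitl L) (coalg_unitr L) (coalg_swap L).

End Laws.

Section Transfer.
Variables (A B : chain_complex k) (j : chain_map A B).
Variables (DA : chain_map A (tensor A A)) (DB : chain_map B (tensor B B)).
Variables (eA : chain_map A (unit_complex k)) (eB : chain_map B (unit_complex k)).
Hypothesis jD : chain_comp DB j = chain_comp (tensor_map j j) DA.
Hypothesis je : chain_comp eB j = eA.

(** This and its analogues below move laws both ways: from [B] to [A] when [j] is injective, and
    from the members of a diagram to their colimit. *)
Lemma coassl_nat : chain_comp (coassl DB) j =
  chain_comp (tensor_map j (tensor_map j j)) (coassl DA).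
Proof.
rewrite /coassl [RHS]chain_compA -associator_nat -!chain_compA jD.
by congr chain_comp; rewrite !chain_compA -!tensor_map_comp jD !chain_comp1 chain_1comp.
Qed.

Lemma coassr_nat : chain_comp (coassr DB) j =
  chain_comp (tensor_map j (tensor_map j j)) (coassr DA).
Proof.
rewrite /coassr -!chain_compA jD !chain_compA -!tensor_map_comp jD.
by rewrite chain_comp1 chain_1comp.
Qed.

Lemma counl_nat : chain_comp (counl DB eB) j =
  chain_comp (tensor_map (chain_id _) j) (counl DA eA).
Proof.
rewrite /counl -!chain_compA jD !chain_compA -!tensor_map_comp je.
by rewrite !chain_comp1 chain_1comp.
Qed.

Lemma counr_nat : chain_comp (counr DB eB) j =
  chain_comp (tensor_map j (chain_id _)) (counr DA eA).
Proof.
rewrite /counr -!chain_compA jD !chain_compA -!tensor_map_comp je.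
by rewrite !chain_comp1 chain_1comp.
Qed.

Lemma coswap_nat : chain_comp (coswap DB) j =
  chain_comp (tensor_map j j) (coswap DA).
Proof. by rewrite /coswap -!chain_compA jD !chain_compA braiding_nat. Qed.

End Transfer.

Lemma chain_mono (A B C : chain_complex k) (j : chain_map B C) (f g : chain_map A B) :
  (forall n, injective (j n)) -> chain_comp j f = chain_comp j g -> f = g.
Proof.
by move=> j_inj E; apply: chain_map_ext => n x; apply: j_inj; rewrite -!chain_compE E.
Qed.

(** Injectivity of [j (x) j] lets the comultiplication factor through [A (x) A]; each law is then
    checked after composing with an injective tensor power of [j] or a product of [j] with an
    identity. *)
Lemma subcoalgebra (A : chain_complex k) (C : cdgc k) (j : chain_map A C) :
  (forall n, injective (j n)) ->
  (forall n x, exists z, tensor_map j j n z = comul C n (j n x)) ->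
  exists D e (L : coalg_laws D e) (f : cdgc_map (cdgc_of L) C),
    forall n x, f n x = j n x.
Proof.
move=> j_inj Dex; have jj_inj := tensor_map_inj j_inj j_inj.
have [D jD] := chain_factor jj_inj (h := chain_comp (comul C) j) Dex.
pose e := chain_comp (counit C) j.
have L : coalg_laws D e.
  have id_inj (X : chain_complex k) n : injective (chain_id X n) by [].
  split.
  - apply: (chain_mono (tensor_map_inj j_inj jj_inj)).
    rewrite -(coassl_nat (esym jD)) -(coassr_nat (esym jD)).
    by congr chain_comp; exact: comulA.
  - apply: (chain_mono (tensor_map_inj (id_inj _) j_inj)).
    rewrite -(counl_nat (esym jD) erefl) -lunit_inv_nat.
    by congr chain_comp; exact: counitl.
  - apply: (chain_mono (tensor_map_inj j_inj (id_inj _))).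
    rewrite -(counr_nat (esym jD) erefl) -runit_inv_nat.
    by congr chain_comp; exact: counitr.
  - apply: (chain_mono jj_inj); rewrite -(coswap_nat (esym jD)) jD.
    by congr chain_comp; exact: comulC.
by exists D, e, L, (@CdgcMap k (cdgc_of L) C j (esym jD) erefl).
Qed.

(* A coalgebra map through which another one factors is automatically
   compatible with the factorization, because [j (x) j] is injective. *)
Lemma cdgc_factor (A B C : cdgc k) (j : cdgc_map B C) (h : cdgc_map A C) :
  (forall n, injective (j n)) -> (forall n x, exists y, j n y = h n x) ->
  {l : cdgc_map A B | cdgc_comp j l = h}.
Proof.
move=> j_inj ex; have [l jl] := chain_factor j_inj ex.
have lD : chain_comp (comul B) l = chain_comp (tensor_map l l) (comul A).
  apply: (chain_mono (tensor_map_inj j_inj j_inj)).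
  rewrite !chain_compA -coalg_map_comul -tensor_map_comp -chain_compA jl.
  exact: coalg_map_comul.
have le : chain_comp (counit B) l = counit A.
  by rewrite -(coalg_map_counit j) -chain_compA jl coalg_map_counit.
by exists (CdgcMap lD le); apply: cdgc_map_ext.
Qed.

End Coalgebra.

(** * Colimits of coalgebras *)

Section Colimit.
Variables (k : fieldType) (I : Type) (D : I -> cdgc k).
Variable arr : forall i j, cdgc_map (D i) (D j) -> Prop.

Section Degree.
Variable n : nat.

(** [{classic _}] supplies the choice structure that the free module asks of its generators. *)
Let gen := {classic {i : I & D i n}}.
Let g i (x : D i n) : fg k gen := fgU k (Tagged (fun i => D i n) x : gen).

Inductive colim_rel : fg k gen -> Prop :=
| colim_rel_lin i c (x y : D i n) : colim_rel (g (c *: x + y) - (c *: g x + g y))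
| colim_rel_arr i j (f : cdgc_map (D i) (D j)) x of arr f :
    colim_rel (g x - g (f n x)).

Definition colim_mod : lmodType k := pres colim_rel.

Definition colim_in_fun i (x : D i n) : colim_mod :=
  pgen colim_rel (Tagged (fun i => D i n) x : gen).

Fact colim_in_linear i : linear (@colim_in_fun i).
Proof.
by move=> c x y; rewrite /colim_in_fun /pgen -linearP; apply/qpi_eq/lspan_gen; left.
Qed.

Definition colim_in i : {linear D i n -> colim_mod} := mklinear (@colim_in_linear i).

Lemma colim_in_arr i j (f : cdgc_map (D i) (D j)) x :
  arr f -> colim_in j (f n x) = colim_in i x.
Proof. by move=> a; apply/esym/qpi_eq/lspan_gen; right. Qed.

Lemma colim_ext (M : lmodType k) (f h : {linear colim_mod -> M}) :
  (forall i x, f (colim_in i x) = h (colim_in i x)) -> f =1 h.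
Proof. by move=> fh; apply: pres_ext => -[i x]; exact: fh. Qed.

Lemma colim_lift (M : lmodType k) (h : forall i, {linear D i n -> M}) :
  (forall i j (f : cdgc_map (D i) (D j)) x, arr f -> h j (f n x) = h i x) ->
  {l : {linear colim_mod -> M} | forall i x, l (colim_in i x) = h i x}.
Proof.
move=> ha; pose h' (t : gen) : M := h (tag t) (tagged t).
have hR u : colim_rel u -> fgl h' u = 0.
  case=> [i c x y|i j f x a].
    by rewrite linearB linearP !fgl_U /h' /= linearP subrr.
  by rewrite linearB !fgl_U /h' /= ha // subrr.
have [l lE] := pres_lift hR; exists l => i x; exact: lE.
Qed.

End Degree.

Lemma colim_d_ex n : {l : {linear colim_mod n.+1 -> colim_mod n} |
  forall i x, l (colim_in n.+1 i x) = colim_in n i (cd (D i) n x)}.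
Proof.
apply: (colim_lift (h := fun i => colim_in n i \o cd (D i) n)) => i j f x a /=.
by rewrite -cmapd colim_in_arr.
Qed.

Definition colim_d n := sval (colim_d_ex n).

Lemma colim_dE n i x :
  colim_d n (colim_in n.+1 i x) = colim_in n i (cd (D i) n x).
Proof. by rewrite /colim_d; case: colim_d_ex => l /= ->. Qed.

Fact colim_dd n x : colim_d n (colim_d n.+1 x) = 0.
Proof.
pose z : {linear colim_mod n.+2 -> colim_mod n} := \0.
apply: (colim_ext (f := colim_d n \o colim_d n.+1) (h := z)) => i y /=.
by rewrite !colim_dE cdd linear0.
Qed.

Definition colim_cx : chain_complex k := ChainComplex colim_dd.

Fact colim_ind n i x :
  colim_in n i (cd (D i) n x) = cd colim_cx n (colim_in n.+1 i x).
Proof. by rewrite /= colim_dE. Qed.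

Definition colim_cx_in i : chain_map (D i) colim_cx := 
  @ChainMap k (D i) colim_cx (fun n => colim_in n i)
    (fun n (x : D i n.+1) => colim_ind x).

Lemma colim_cx_in_arr i j (f : cdgc_map (D i) (D j)) :
  arr f -> chain_comp (colim_cx_in j) f = colim_cx_in i.
Proof. by move=> a; apply: chain_map_ext => n x; exact: colim_in_arr. Qed.

Lemma colim_cx_ext (X : chain_complex k) (f h : chain_map colim_cx X) :
  (forall i, chain_comp f (colim_cx_in i) = chain_comp h (colim_cx_in i)) -> f = h.
Proof.
move=> fh; apply: chain_map_ext => n; apply: colim_ext => i x.
by have := congr1 (fun p : chain_map (D i) X => p n x) (fh i).
Qed.

Lemma colim_cx_lift (X : chain_complex k) (h : forall i, chain_map (D i) X) :
  (forall i j (f : cdgc_map (D i) (D j)), arr f -> chain_comp (h j) f = h i) ->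
  {l : chain_map colim_cx X | forall i, chain_comp l (colim_cx_in i) = h i}.
Proof.
move=> ha; have ha' n i j (f : cdgc_map (D i) (D j)) x : arr f -> h j n (f n x) = h i n x.
  by move=> /ha <-.
pose l n := sval (colim_lift (@ha' n)).
have lE n i x : l n (colim_in n i x) = h i n x by rewrite /l; case: colim_lift.
have ld n x : l n (cd colim_cx n x) = cd X n (l n.+1 x).
  apply: (colim_ext (f := l n \o cd colim_cx n) (h := cd X n \o l n.+1)) => i y /=.
  by rewrite colim_dE !lE cmapd.
by exists (ChainMap ld) => i; apply: chain_map_ext => n x; exact: lE.
Qed.

(** The right-hand sides form a cocone because the arrows of the diagram are coalgebra maps. *)
Lemma colim_comul_ex : {l : chain_map colim_cx (tensor colim_cx colim_cx) |
  forall i, chain_comp l (colim_cx_in i) =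
    chain_comp (tensor_map (colim_cx_in i) (colim_cx_in i)) (comul (D i))}.
Proof.
apply: colim_cx_lift => i j f a.
by rewrite -chain_compA coalg_map_comul chain_compA -tensor_map_comp colim_cx_in_arr.
Qed.

Lemma colim_counit_ex : {l : chain_map colim_cx (unit_complex k) |
  forall i, chain_comp l (colim_cx_in i) = counit (D i)}.
Proof. by apply: colim_cx_lift => i j f a; exact: coalg_map_counit. Qed.

Definition colim_comul := sval colim_comul_ex.
Definition colim_counit := sval colim_counit_ex.

Lemma colim_comulE i : chain_comp colim_comul (colim_cx_in i) =
  chain_comp (tensor_map (colim_cx_in i) (colim_cx_in i)) (comul (D i)).
Proof. exact: (svalP colim_comul_ex). Qed.

Lemma colim_counitE i : chain_comp colim_counit (colim_cx_in i) = counit (D i).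
Proof. exact: (svalP colim_counit_ex). Qed.

(** Maps out of the colimit are determined on the [D i], where naturality reduces each law to that
    of [D i]. *)
Lemma colim_laws : coalg_laws colim_comul colim_counit.
Proof.
split; apply: colim_cx_ext => i.
- rewrite (coassl_nat (colim_comulE i)) (coassr_nat (colim_comulE i)).
  by congr chain_comp; exact: comulA.
- rewrite (counl_nat (colim_comulE i) (colim_counitE i)) lunit_inv_nat.
  by congr chain_comp; exact: counitl.
- rewrite (counr_nat (colim_comulE i) (colim_counitE i)) runit_inv_nat.
  by congr chain_comp; exact: counitr.
- rewrite (coswap_nat (colim_comulE i)) colim_comulE.
  by congr chain_comp; exact: comulC.
Qed.

Definition colim : cdgc k := cdgc_of colim_laws.

Definition colim_cdgc_in i : cdgc_map (D i) colim :=
  @CdgcMap k (D i) colim (colim_cx_in i) (colim_comulE i) (colim_counitE i).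

End Colimit.

(** * Countably generated subcoalgebras *)

Section CountablyGenerated.
Variable k : fieldType.

(* Indexing by all coalgebras over X instead would raise the universe level of
   the colimit; the carriers are therefore restricted to quotients of the free
   module on nat. *)
Record cofree_index (X : chain_complex k) := CofreeIndex {
  ci_rel : forall n : nat, fg k nat -> Prop;
  ci_d : forall n, {linear pres (ci_rel n.+1) -> pres (ci_rel n)};
  ci_dd : forall n x, ci_d n (ci_d n.+1 x) = 0;
  ci_cx := @ChainComplex k (fun n => pres (ci_rel n)) ci_d ci_dd;
  ci_comul : chain_map ci_cx (tensor ci_cx ci_cx);
  ci_counit : chain_map ci_cx (unit_complex k);
  ci_laws : coalg_laws ci_comul ci_counit;
  ci_coalg := cdgc_of ci_laws;
  ci_map : chain_map ci_coalg X
}.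

(* An elimination rule for [t], saying that it is a combination of pure tensors
   of the entries of [a]. *)
Lemma tens_decomp (X Y : nat -> lmodType k) n (t : tens X Y n) :
  exists a : nat -> {i & X i} * {j & Y j}, forall P : tens X Y n -> Prop,
    P 0 -> (forall c u v, P u -> P v -> P (c *: u + v)) ->
    (forall m (e : (tag (a m).1 + tag (a m).2)%N = n),
       P (pure e (tagged (a m).1) (tagged (a m).2))) -> P t.
Proof.
elim/tens_ind: t => [|c u v [a ua] [b vb]|i j e x y].
- by exists (fun=> (Tagged X (0 : X 0%N), Tagged Y (0 : Y 0%N))).
(* Interleaving: odd positions list the factors for [u], even ones those for [v]. *)
- exists (fun m => if odd m then a m./2 else b m./2) => P P0 PD Pa.
  apply: (PD).
    by apply: (ua P P0 PD) => m; have := Pa m.*2.+1;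
      rewrite /= odd_double uphalf_double.
  by apply: (vb P P0 PD) => m; have := Pa m.*2; rewrite /= odd_double doubleK.
- by exists (fun=> (Tagged X x, Tagged Y y)) => P _ _ /(_ 0%N); exact.
Qed.

Section Closure.
Variables (C : cdgc k) (B : countType) (rho : B -> {n & C n : Type}).

Let Cn n : Type := C n.
Let T := {n & Cn n}.

Let factors (t : T) : nat -> T * T :=
  sval (cid (tens_decomp (comul C (tag t) (tagged t)))).

(** No differential leaves degree 0, so the value there is a default zero. *)
Let dT (t : T) : T :=
  match t with
  | existT 0 x => Tagged Cn (0 : C 0%N)
  | existT n.+1 x => Tagged Cn (cd C n x)
  end.

(* The generators of the subcoalgebra are words: [None] takes the differential,
   [Some (m, b)] the left or right factor of the m-th pure tensor in a
   decomposition of the coproduct. *)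
Let step (l : option (nat * bool)) (t : T) : T :=
  match l with
  | None => dT t
  | Some (m, b) => if b then (factors t m).1 else (factors t m).2
  end.

Let term : countType := (B * seq (option (nat * bool)))%type.
Let ev (w : term) : T := foldr step (rho w.1) w.2.

(** Words are countable, so [nat] enumerates them in every degree; numbers coding no word, or a word
    whose value has another degree, stand for 0. *)
Let gen n (b : nat) : C n :=
  if unpickle b is Some w then untag 0 (fun x : C n => x) (ev w) else 0.

Let genP n b : gen n b = 0 \/ exists w, ev w = Tagged Cn (gen n b).
Proof.
rewrite /gen; case: unpickle => [w|]; last by left.
case: (tag (ev w) =P n) => [e|/eqP ne]; last by left; rewrite untag_dflt.
by right; exists w; rewrite (untagE _ _ e) etaggedK.
Qed.

Let genT (w : term) : gen (tag (ev w)) (pickle w) = tagged (ev w).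
Proof. by rewrite /gen pickleK (untagE _ _ (erefl (tag (ev w)))). Qed.

(** Taking the whole kernel of the evaluation map as relations makes [j] injective, with image the
    span of the generators. *)
Let rel n (u : fg k nat) : Prop := fgl (gen n) u = 0.
Let F n : lmodType k := pres (rel n).
Let j n : {linear F n -> C n} := qlift (fun u (Ru : rel n u) => Ru).

Let jE n b : j n (pgen (rel n) b) = gen n b.
Proof. by rewrite /j qlift_pi fgl_U. Qed.

Let j_inj n : injective (j n).
Proof.
move=> x y /eqP; rewrite -subr_eq0 -linearB => /eqP j0.
apply/eqP; rewrite -subr_eq0; apply/eqP; move: (x - y) j0 => z.
rewrite -(qpiK z) /j qlift_pi => z0.
by rewrite -[0](linear0 (qpi (rel n))); apply/qpi_eq/lspan_gen; rewrite subr0.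
Qed.

Let j_ev w : exists y, j (tag (ev w)) y = tagged (ev w).
Proof. by exists (pgen _ (pickle w)); rewrite jE genT. Qed.

Let j_ev' w t : ev w = t -> exists y, j (tag t) y = tagged t.
Proof. by move=> <-; exact: j_ev. Qed.

(** On a generator given by a word, the differential is the value of that word prefixed by
    [None]. *)
Let j_d n y : exists z, j n z = cd C n (j n.+1 y).
Proof.
elim/pres_ind: y => [|c u v [u' ju] [v' jv]|b].
- by exists 0; rewrite !linear0.
- by exists (c *: u' + v'); rewrite !linearP ju jv.
rewrite jE; have [->|[[r w] wE]] := genP n.+1 b; first by exists 0; rewrite !linear0.
apply: (@j_ev' (r, None :: w) (Tagged Cn _)).
by rewrite /ev /= -[foldr _ _ _]/(ev (r, w)) wE.
Qed.

Let d n := sval (linear_factor (h := cd C n \o j n.+1) (@j_inj n) (@j_d n)).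

Let dE n x : j n (d n x) = cd C n (j n.+1 x).
Proof. by rewrite /d; case: linear_factor. Qed.

Let dd n x : d n (d n.+1 x) = 0.
Proof. by apply: j_inj; rewrite !dE cdd linear0. Qed.

Let FC : chain_complex k := ChainComplex dd.
Let jc : chain_map FC C := @ChainMap k FC C j dE.

(** Prefixing a word by [Some (m, _)] puts both factors of every pure tensor of its coproduct in the
    image of [j]. *)
Let j_comul n y : exists z, tensor_map jc jc n z = comul C n (jc n y).
Proof.
rewrite -[jc n]/(j n); elim/pres_ind: y => [|c u v [u' ju] [v' jv]|b].
- by exists 0; rewrite !linear0.
- by exists (c *: u' + v'); rewrite !linearP ju jv.
rewrite jE; have [->|[[r w] wE]] := genP n b; first by exists 0; rewrite !linear0.
have fE m : exists x, j (tag (factors (Tagged Cn (gen n b)) m).1) x =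
    tagged (factors (Tagged Cn (gen n b)) m).1.
  by apply: (@j_ev' (r, Some (m, true) :: w)); rewrite -wE.
have fE' m : exists x, j (tag (factors (Tagged Cn (gen n b)) m).2) x =
    tagged (factors (Tagged Cn (gen n b)) m).2.
  by apply: (@j_ev' (r, Some (m, false) :: w)); rewrite -wE.
(* The elimination rule of [tens_decomp] is applied to membership in the image of [jc (x) jc]. *)
move: fE fE'; rewrite /factors; case: cid => a /= aP fE fE'; 
apply: (aP (fun t => exists z, tensor_map jc jc n z = t)).
- by exists 0; rewrite linear0.
- by move=> c u v [u' ju] [v' jv]; exists (c *: u' + v'); rewrite linearP ju jv.
move=> m e; have [x jx] := fE m; have [y jy] := fE' m.
by exists (pure e x y); rewrite tensor_map_pure -jx -jy.
Qed.

(** The seed [rho b] is reached by the empty word. Countable families of seeds allow one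
    subcoalgebra to contain the generators of two others. *)
Lemma countable_subcoalgebra (X : chain_complex k) (p : chain_map C X) :
  exists (s : cofree_index X) (f : cdgc_map (ci_coalg s) C),
  [/\ forall n, injective (f n), chain_comp p f = ci_map s &
      forall b, exists y, f (tag (rho b)) y = tagged (rho b)].
Proof.
have [D [e [L [f fE]]]] := subcoalgebra (j := jc) j_inj j_comul.
exists (@CofreeIndex X rel d dd D e L (chain_comp p f)), f; split=> //.
  by move=> n x y; rewrite !fE; exact: j_inj.
by move=> b; have [y yE] := j_ev (b, [::]); exists y; rewrite fE.
Qed.

End Closure.
End CountablyGenerated.

(** * The cofree coalgebra and its universal property *)

Section Cofree.
Variables (k : fieldType) (X : chain_complex k).

Let over (i j : cofree_index X) (f : cdgc_map (ci_coalg i) (ci_coalg j)) : Prop :=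
  chain_comp (ci_map j) f = ci_map i.

Definition cofree : cdgc k := colim over.

Definition cofree_in (i : cofree_index X) : cdgc_map (ci_coalg i) cofree :=
  colim_cdgc_in over i.

Lemma cofree_counit_ex : {l : chain_map cofree X |
  forall i, chain_comp l (cofree_in i) = ci_map i}.
Proof. exact: (colim_cx_lift (arr := over)). Qed.

Definition cofree_counit : chain_map cofree X := sval cofree_counit_ex.

Lemma cofree_counitE i : chain_comp cofree_counit (cofree_in i) = ci_map i.
Proof. exact: (svalP cofree_counit_ex). Qed.

Section Universal.
Variables (C : cdgc k) (p : chain_map C X).

(** Directedness: the images in [C] of the generators of [i1] and [i2] form a countable family, and
    the subcoalgebra it generates receives both by [cdgc_factor]. *)
Lemma cofree_index_merge (i1 i2 : cofree_index X)
    (f1 : cdgc_map (ci_coalg i1) C) (f2 : cdgc_map (ci_coalg i2) C) :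
  chain_comp p f1 = ci_map i1 -> chain_comp p f2 = ci_map i2 ->
  exists (i : cofree_index X) (f : cdgc_map (ci_coalg i) C) l1 l2,
  [/\ forall n, injective (f n), chain_comp p f = ci_map i,
      over l1 /\ cdgc_comp f l1 = f1 & over l2 /\ cdgc_comp f l2 = f2].
Proof.
(* The index [(s, n, m)] selects the coalgebra, the degree and the generator. *)
move=> p1 p2; pose rho (b : bool * nat * nat) : {n & C n : Type} :=
  let: (s, n, m) := b in
  Tagged (fun n => C n : Type)
    (if s then f1 n (pgen (@ci_rel _ _ i1 n) m)
     else f2 n (pgen (@ci_rel _ _ i2 n) m)).
have [i [f [f_inj pf cover]]] := countable_subcoalgebra rho p.
have cov1 n x : exists y, f n y = f1 n x.
  elim/pres_ind: x => [|c u v [u' fu] [v' fv]|m]; last exact: (cover (true, n, m)).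
    by exists 0; rewrite !linear0.
  by exists (c *: u' + v'); rewrite !linearP fu fv.
have cov2 n x : exists y, f n y = f2 n x.
  elim/pres_ind: x => [|c u v [u' fu] [v' fv]|m]; last exact: (cover (false, n, m)).
    by exists 0; rewrite !linear0.
  by exists (c *: u' + v'); rewrite !linearP fu fv.
have [l1 fl1] := cdgc_factor f_inj cov1; have [l2 fl2] := cdgc_factor f_inj cov2.
exists i, f, l1, l2; split=> //; split=> //.
  by rewrite /over -pf -p1 -fl1 -chain_compA.
by rewrite /over -pf -p2 -fl2 -chain_compA.
Qed.

(** The graph of the map from [C] to [cofree]: lift [c] to some indexed coalgebra over [C] and take
    the class of the lift. *)
Definition cofree_graph n (c : C n) (t : cofree n) : Prop :=
  exists (i : cofree_index X) (f : cdgc_map (ci_coalg i) C) (y : ci_coalg i n),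
  [/\ chain_comp p f = ci_map i, f n y = c & cofree_in i n y = t].

Lemma cofree_graph_total n (c : C n) : exists t, cofree_graph c t.
Proof.
have [i [f [_ pf /(_ tt)[y /= yE]]]] :=
  countable_subcoalgebra (fun _ : unit => Tagged (fun n => C n : Type) c) p.
by exists (cofree_in i n y), i, f, y.
Qed.

Lemma cofree_in_over i j (f : cdgc_map (ci_coalg i) (ci_coalg j)) n x :
  over f -> cofree_in j n (f n x) = cofree_in i n x.
Proof. exact: colim_in_arr. Qed.

(** Two lifts of [c] can be moved, without changing their classes, into a common coalgebra that
    embeds in [C]; there they coincide. *)
Lemma cofree_graph_uniq n (c : C n) t t' :
  cofree_graph c t -> cofree_graph c t' -> t = t'.
Proof.
move=> [i [f [y [pf fy <-]]]] [i' [f' [y' [pf' fy' <-]]]].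
have [s [g [l [l' [g_inj _ [lo gl] [lo' gl']]]]]] := cofree_index_merge pf pf'.
rewrite -(cofree_in_over _ lo) -(cofree_in_over _ lo'); congr (cofree_in _ _ _).
by apply: g_inj; move: fy fy'; rewrite -gl -gl' /= => -> ->.
Qed.

Definition cofree_fun n (c : C n) : cofree n := sval (cid (cofree_graph_total c)).

Lemma cofree_funE n (i : cofree_index X) (f : cdgc_map (ci_coalg i) C) y :
  chain_comp p f = ci_map i -> cofree_fun (f n y) = cofree_in i n y.
Proof.
move=> pf; rewrite /cofree_fun; case: cid => t /= gt.
by apply: cofree_graph_uniq gt _; exists i, f, y.
Qed.

Lemma cofree_cover n (c : C n) :
  exists (i : cofree_index X) (f : cdgc_map (ci_coalg i) C) y,
  chain_comp p f = ci_map i /\ f n y = c.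
Proof. by have [_ [i [f [y [pf fy _]]]]] := cofree_graph_total c; exists i, f, y. Qed.

Fact cofree_fun_linear n : linear (@cofree_fun n).
Proof.
move=> a c c'; have [i1 [f1 [y1 [p1 <-]]]] := cofree_cover c.
have [i2 [f2 [y2 [p2 <-]]]] := cofree_cover c'.
(* Both elements now come from one coalgebra, where the combination can be formed before passing to
   classes. *)
have [i [f [l1 [l2 [_ pf [_ <-] [_ <-]]]]]] := cofree_index_merge p1 p2.
by rewrite /= -linearP !cofree_funE // linearP.
Qed.

Fact cofree_fund n (c : C n.+1) :
  mklinear (@cofree_fun_linear n) (cd C n c) =
  cd cofree n (mklinear (@cofree_fun_linear n.+1) c).
Proof.
have [i [f [y [pf <-]]]] := cofree_cover c.
by rewrite -cmapd /= /linear_fun_of !cofree_funE // cmapd.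
Qed.

Definition cofree_chain : chain_map C cofree :=
  @ChainMap k C cofree (fun n => mklinear (@cofree_fun_linear n)) (@cofree_fund).

Lemma cofree_chainE (i : cofree_index X) (f : cdgc_map (ci_coalg i) C) :
  chain_comp p f = ci_map i -> chain_comp cofree_chain f = cofree_in i.
Proof. by move=> pf; apply: chain_map_ext => n y; exact: cofree_funE. Qed.

(** By [cofree_cover] the indexed coalgebras over [C] are jointly surjective, so identities of chain
    maps out of [C] can be tested on them. *)
Lemma cofree_epi (Y : chain_complex k) (g h : chain_map C Y) :
  (forall (i : cofree_index X) (f : cdgc_map (ci_coalg i) C),
     chain_comp p f = ci_map i -> chain_comp g f = chain_comp h f) -> g = h.
Proof.
move=> gh; apply: chain_map_ext => n c; have [i [f [y [pf <-]]]] := cofree_cover c.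
by rewrite -!chain_compE gh.
Qed.

Fact cofree_chain_comul : chain_comp (comul cofree) cofree_chain =
  chain_comp (tensor_map cofree_chain cofree_chain) (comul C).
Proof.
apply: cofree_epi => i f pf; rewrite -!chain_compA (coalg_map_comul f).
by rewrite [RHS]chain_compA -tensor_map_comp cofree_chainE // coalg_map_comul.
Qed.

Fact cofree_chain_counit : chain_comp (counit cofree) cofree_chain = counit C.
Proof.
apply: cofree_epi => i f pf.
by rewrite -chain_compA cofree_chainE // !coalg_map_counit.
Qed.

Definition cofree_lift : cdgc_map C cofree :=
  CdgcMap cofree_chain_comul cofree_chain_counit.

Lemma cofree_liftK : chain_comp cofree_counit cofree_lift = p.
Proof.
by apply: cofree_epi => i f pf; rewrite -chain_compA cofree_chainE // cofree_counitE pf.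
Qed.

End Universal.

(** Each [cofree_in i] is itself an indexed coalgebra map over X into [cofree], so the lift sends it
    to [cofree_in i]. *)
Lemma cofree_lift_counit : cofree_lift cofree_counit = cdgc_id cofree.
Proof.
apply/cdgc_map_ext/(colim_cx_ext (arr := over)) => i.
by rewrite chain_comp1; exact: cofree_chainE (cofree_counitE i).
Qed.

(* [cofree_lift] depends naturally on the coalgebra over X, so [g] differs from
   [cofree_lift p] by [cofree_lift cofree_counit], which is the identity. *)
Lemma cofree_lift_uniq (C : cdgc k) (p : chain_map C X) (g : cdgc_map C cofree) :
  chain_comp cofree_counit g = p -> g = cofree_lift p.
Proof.
move=> gp; apply/cdgc_map_ext/(cofree_epi (p := p)) => i f pf.
rewrite cofree_chainE // -[g]cdgc_comp1 -cofree_lift_counit.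
rewrite -chain_compA -[chain_comp g f]/(coalg_map (cdgc_comp g f)).
apply: cofree_chainE.
by rewrite -pf -gp -chain_compA.
Qed.

End Cofree.

(** * Functoriality and the adjunction *)

Section Adjunction.
Variable k : fieldType.

Definition cofree_map (X Y : chain_complex k) (f : chain_map X Y) :
  cdgc_map (cofree X) (cofree Y) :=
  cofree_lift (chain_comp f (cofree_counit X)).

(** Both sides have the same composite with [cofree_counit]. This yields compatibility of
    [cofree_map] with composition and naturality of the bijection in the complex. *)
Lemma cofree_map_lift (C : cdgc k) (X Y : chain_complex k) (f : chain_map X Y)
    (p : chain_map C X) :
  cdgc_comp (cofree_map f) (cofree_lift p) = cofree_lift (chain_comp f p).
Proof.
by apply: cofree_lift_uniq; rewrite chain_compA cofree_liftK -chain_compA cofree_liftK.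
Qed.

Fact cofree_map1 X : cofree_map (chain_id X) = cdgc_id (cofree X).
Proof. by rewrite /cofree_map chain_comp1 cofree_lift_counit. Qed.

Fact cofree_mapM X Y Z (g : chain_map Y Z) (f : chain_map X Y) :
  cofree_map (chain_comp g f) = cdgc_comp (cofree_map g) (cofree_map f).
Proof. by rewrite cofree_map_lift chain_compA. Qed.

Definition cofree_functor : functor (Ch k) (CDGC k) :=
  @Functor (Ch k) (CDGC k) (@cofree k) cofree_map cofree_map1 cofree_mapM.

Fact cofree_lift_bij (C : cdgc k) (X : chain_complex k) :
  bijective (@cofree_lift k X C).
Proof.
exists (fun g : cdgc_map C (cofree X) => chain_comp (cofree_counit X) g) => [p|g].
  exact: cofree_liftK.
by rewrite -(cofree_lift_uniq erefl).
Qed.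

Fact cofree_lift_natl (C C' : cdgc k) (X : chain_complex k) (f : cdgc_map C' C)
    (p : chain_map C X) :
  cofree_lift (chain_comp p f) = cdgc_comp (cofree_lift p) f.
Proof. by apply/esym/cofree_lift_uniq; rewrite chain_compA cofree_liftK. Qed.

Definition cofree_adjunction : adjunction (forgetful k) cofree_functor :=
  @Adjunction (CDGC k) (Ch k) (forgetful k) cofree_functor
    (fun C X => @cofree_lift k X C) cofree_lift_bij cofree_lift_natl
    (fun C X Y f p => esym (cofree_map_lift f p)).

End Adjunction.

Theorem theorem8 (k : fieldType) :
  exists C : functor (Ch k) (CDGC k), inhabited (adjunction (forgetful k) C).
Proof. by exists (cofree_functor k); split; exact: cofree_adjunction. Qed.
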